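(* Let $f_0\in L_2([0,1]^p)$, $m\in\mathbb{N}_+$, $\delta>0$, and let $\mathcal{F}_m(\delta)$ be a class of functions on $[0,1]^p$ such that, for some constant $\eta>0$, $$f\in\mathcal{F}_m(\delta)\ \Longrightarrow\ \|f-f_0\|_\infty^2\le \eta\left(m\|f-f_0\|_2^2+\delta^2\right).$$ Then there exist constants $C>0$ and $\xi\in(0,1)$ (depending only on $\eta$ and $\sigma$) such that for any $f_1\in\mathcal{F}_m(\delta)$ with $\sqrt{n}\,\|f_1-f_0\|_2>1$ there exists a test function $\phi_n:([0,1]^p\times\mathbb{R})^n\to[0,1]$ satisfying $$\mathbb{E}_0\phi_n\le \exp\left(-Cn\|f_1-f_0\|_2^2\right),$$ $$\sup_{\{f\in\mathcal{F}_m(\delta):\,\|f-f_1\|_2\le \xi\|f_0-f_1\|_2\}}\mathbb{E}_f(1-\phi_n)\le \exp\left(-Cn\|f_1-f_0\|_2^2\right)+2\exp\left(-\frac{Cn\|f_1-f_0\|_2^2}{m\|f_1-f_0\|_2^2+\delta^2}\right).$$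
   Context: Random-design regression: $\mathbf{x}_1,\dots,\mathbf{x}_n$ are i.i.d. uniform on $[0,1]^p$ ($p$ fixed), $y_i=f(\mathbf{x}_i)+e_i$ with $e_i$ i.i.d. $\mathrm{N}(0,\sigma^2)$ independent of the design points, $\sigma^2>0$ known. The data are $\mathcal{D}_n=(\mathbf{x}_i,y_i)_{i=1}^n$. $\mathbb{E}_f$ denotes expectation when the regression function is $f$, i.e. the pairs $(\mathbf{x}_i,y_i)$ are i.i.d. with density $p_f(\mathbf{x},y)=\phi_\sigma(y-f(\mathbf{x}))$ on $[0,1]^p\times\mathbb{R}$, where $\phi_\sigma$ is the $\mathrm{N}(0,\sigma^2)$ density; $\mathbb{E}_0=\mathbb{E}_{f_0}$. A test function $\phi_n$ is evaluated at the data $\mathcal{D}_n$. $\|\cdot\|_2$ is the integrated $L_2$-norm with respect to Lebesgue measure on $[0,1]^p$ and $\|\cdot\|_\infty$ the sup-norm. *)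

(* Defs.v *)
From HB Require Import structures.
From mathcomp Require Import all_boot all_order all_algebra.
From mathcomp Require Import all_classical all_reals all_analysis.
Set Implicit Arguments.
Unset Strict Implicit.
Unset Printing Implicit Defensive.
Import Order.TTheory GRing.Theory Num.Theory.
Import numFieldNormedType.Exports.
Local Open Scope classical_set_scope.
Local Open Scope ring_scope.

Section iid_law.
Context d (T : measurableType d) (R : realType).

Definition tcons n (x : T * n.-tuple T) : n.+1.-tuple T :=
  [tuple of x.1 :: x.2].

Lemma measurable_tcons n : measurable_fun setT (@tcons n).
Proof. exact: measurable_cons. Qed.

HB.instance Definition _ n :=
  isMeasurableFun.Build _ _ _ _ (@tcons n) (@measurable_tcons n).

(* The n-fold product P \x ... \x P, carried over to n-tuples. *)
Fixpoint iid_law (P : probability T R) n : probability (n.-tuple T) R :=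
  match n with
  | 0 => dirac [tuple]
  | k.+1 => distribution (P \x iid_law P k)%E (@tcons k)
  end.

Lemma iid_law_box (P : probability T R) n (A : 'I_n -> set T) :
  (forall i, measurable (A i)) ->
  iid_law P n [set t | forall i, A i (tnth t i)] = (\prod_(i < n) P (A i))%E.
Proof.
elim: n A => [|n IH] A mA /=.
  rewrite big_ord0 diracE mem_set//= => -[]//.
rewrite big_ord_recl -IH//.
rewrite /distribution /pushforward.
rewrite -product_measure1E//; last first.
  rewrite (_ : [set _ | _] = \bigcap_(i in [set: 'I_n])
     ((fun t : n.-tuple T => tnth t i) @^-1` A (lift ord0 i))); last first.
    by apply/seteqP; split => t //= H i; [move=> _|]; exact: H.
  apply: fin_bigcap_measurable => // i _.
  by rewrite -[X in measurable X]setTI; exact: measurable_tnth.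
congr (_ _); apply/seteqP; split => -[x t]/=.
  move=> H; split; first exact: (H ord0).
  by move=> i; have := H (lift ord0 i); rewrite /tcons/= tnthS.
move=> [H0 H] i.
have [->//|] := eqVneq i ord0.
rewrite eq_sym => /unlift_some[j -> _]; rewrite /tcons tnthS; exact: H.
Qed.

End iid_law.

(* The measures of the library on the real line live on measurableTypeR R,
   that is, on R with its Borel sigma-algebra. *)
Notation design R p := (p.-tuple (measurableTypeR R)).
Notation sample R p n := (n.-tuple (design R p * measurableTypeR R)%type).

Section random_design_regression.
Context {R : realType}.
Implicit Types (p n : nat) (sigma : R).

Definition cube p : set (design R p) :=
  [set x | forall i, 0 <= (tnth x i : R) <= 1].

(* The uniform law on [0,1]^p, i.e., Lebesgue measure restricted to the cube,
   as a law on R^p. A function on [0,1]^p is represented by a function on R^p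
   whose values outside the cube play no role, up to global measurability. *)
Definition unif_cube p : probability (design R p) R :=
  iid_law (uniform_prob (@ltr01 R)) p.

Definition L2 p : set (design R p -> R) := [set` Lfun (unif_cube p) 2%:E].

Definition L2norm p (g : design R p -> R) : R :=
  fine ('N[unif_cube p]_(2%:E)[EFin \o g])%E.

(* Pointwise supremum over the cube, +oo for unbounded functions. *)
Definition supnorm p (g : design R p -> R) : \bar R :=
  ereal_sup [set `|g x|%:E | x in @cube p].

(* The observations (x_i, y_i) with y_i = f(x_i) + e_i, as a function of the
   design points and noise variables (x_i, e_i). *)
Definition data p n (f : design R p -> R) (w : sample R p n) : sample R p n :=
  map_tuple (fun xe => (xe.1, f xe.1 + xe.2)) w.

(* E_f of a statistic psi of the data: the x_i are uniform on the cube, the e_i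
   are N(0, sigma^2), and all of them are independent. *)
Definition Ef p n sigma (f : design R p -> R) (psi : sample R p n -> R)
    : \bar R :=
  'E_(iid_law (unif_cube p \x normal_prob 0 sigma)%E n)[psi \o data f].

End random_design_regression.

(* Main.v *)
(* Put g = f1 - f0 and let D be its L2-norm. The test is the likelihood ratio
   test rejecting f0 when S = sum_i ((y_i - f0 x_i) g x_i - g(x_i)^2 / 4)
   exceeds n D^2 / 32. Both errors are exponential moments of S, which by
   independence are n-th powers of an integral over one design point once the
   Gaussian noise is integrated out. Under f0 the tilt 1 / (2 sigma^2) makes
   that integrand constant. Under f = f1 + h, a tilt l leaves at most
   exp (- l (g^2 / 4 - h^2)); the sup-norm condition bounds g^2 and h^2 by
   B = 8 eta (m D^2 + delta^2), and for l <= 1 / (4 B) a second-order expansion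
   gives the bound exp (- l D^2 / 16). The minimum of the two constraints
   l <= 1 / (2 sigma^2) and l <= 1 / (4 B) produces the two exponential terms. *)
Require Import Defs.
From mathcomp Require Import all_boot all_order all_algebra.
From mathcomp Require Import all_classical all_reals all_analysis.
From mathcomp Require Import measurable_realfun ring lra.
Set Implicit Arguments.
Unset Strict Implicit.
Import Order.TTheory GRing.Theory Num.Theory.
Import numFieldNormedType.Exports.
Local Open Scope classical_set_scope.
Local Open Scope ring_scope.

(** * Gaussian integrals and products over i.i.d. samples *)

(** The Radon-Nikodym derivative of the normal law agrees almost everywhere with [normal_pdf], since
    both have the same integral over every measurable set; the rest is change of variables. *)
Lemma ge0_integral_normal_prob (R : realType) (m s : R)
    (f : R -> \bar R) :
  measurable_fun setT f -> (forall x, (0 <= f x)%E) ->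
  (\int[normal_prob m s]_x f x =
   \int[lebesgue_measure]_x (f x * (normal_pdf m s x)%:E))%E.
Proof.
move=> mf f0.
have dom := normal_prob_dominates m s.
have mpdf : measurable_fun setT (fun x => (normal_pdf m s x)%:E).
  by apply/measurable_EFinP; exact: measurable_normal_pdf.
rewrite -(Radon_Nikodym_SigmaFinite.change_of_variables dom)//.
have iRN := Radon_Nikodym_SigmaFinite.f_integrable dom.
apply: ae_eq_integral => //.
- by apply: emeasurable_funM => //; exact: measurable_int iRN.
- exact: emeasurable_funM.
- apply: ae_eqe_mul2l; apply: integral_ae_eq => // E _ mE.
  by rewrite -Radon_Nikodym_SigmaFinite.f_integral.
Qed.

(** Completing the square: tilting the density by [expR (b * x)] only moves its mean to
    [b * s ^+ 2], up to a constant factor. *)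
Lemma normal_prob_mgf (R : realType) (s a b : R) : s != 0 ->
  (\int[normal_prob 0 s]_x (expR (a + b * x))%:E =
   (expR (a + b ^+ 2 * s ^+ 2 / 2))%:E)%E.
Proof.
move=> s0; rewrite ge0_integral_normal_prob; last 2 first.
- apply/measurable_EFinP/measurableT_comp => //.
  by apply: measurable_funD => //; exact: measurable_funM.
- by move=> x; rewrite lee_fin expR_ge0.
have tilt x : expR (a + b * x) * normal_pdf 0 s x =
    expR (a + b ^+ 2 * s ^+ 2 / 2) * normal_pdf (b * s ^+ 2) s x.
  rewrite !normal_pdfE//= /normal_fun mulrCA [RHS]mulrCA.
  rewrite -!expRD.
  by congr (_ * expR _); field.
under eq_integral do rewrite -EFinM tilt EFinM.
rewrite ge0_integralZl_EFin ?expR_ge0//.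
- by rewrite integral_normal_pdf mule1.
- by move=> x _; rewrite lee_fin normal_pdf_ge0.
- by apply/measurable_EFinP; exact: measurable_normal_pdf.
Qed.

(** Induction on n: [tcons] splits off the first coordinate, and by Tonelli the tail integrates to a
    constant that factors out. *)
Lemma integral_iid_law_prod d (T : measurableType d) (R : realType)
    (P : probability T R) n (k : T -> R) :
  measurable_fun setT k -> (forall x, 0 <= k x) ->
  (\int[iid_law P n]_t (\prod_(i < n) k (tnth t i))%:E =
   (\int[P]_x (k x)%:E) ^+ n)%E.
Proof.
move=> mk k0; elim: n => [|n IH].
  by under eq_integral do rewrite big_ord0; rewrite integral_dirac// diracT mul1e.
have mprod j : measurable_fun setT
    (fun t : j.-tuple T => (\prod_(i < j) k (tnth t i))%:E).
  apply/measurable_EFinP; apply: measurable_prod => i _.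
  by apply: measurableT_comp => //; exact: measurable_tnth.
have prod0 j (t : j.-tuple T) : (0 <= (\prod_(i < j) k (tnth t i))%:E)%E.
  by rewrite lee_fin prodr_ge0.
rewrite expeS /= ge0_integral_distribution; [|exact: mprod|exact: prod0].
under eq_integral => x _.
  rewrite /= big_ord_recl/= (_ : tnth _ ord0 = x.1)//.
  under eq_bigr do rewrite /tcons tnthS/=.
  over.
rewrite fubini_tonelli1; last 2 first.
- apply/measurable_EFinP; apply: measurable_funM; first exact: measurableT_comp.
  apply: measurable_prod => i _; apply: measurableT_comp => //.
  by apply: (measurableT_comp (measurable_tnth i)).
- by move=> x; rewrite lee_fin mulr_ge0// prodr_ge0.
rewrite /fubini_F/=.
under eq_integral => x _.
  under eq_integral do rewrite EFinM.
  rewrite ge0_integralZl_EFin//; [|by move=> t _; exact: prod0|exact: mprod].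
  rewrite IH; over.
rewrite /= ge0_integralZr//.
- exact/measurable_EFinP.
- by move=> x _; rewrite lee_fin.
- by apply: expe_ge0; apply: integral_ge0 => x _; rewrite lee_fin.
Qed.

(** * The uniform law on the cube, the two norms and elementary inequalities *)

Lemma measurable_cube (R : realType) p : measurable (@cube R p).
Proof.
rewrite (_ : @cube R p = \bigcap_(i in [set: 'I_p])
    ((fun x : design R p => tnth x i) @^-1` `[0, 1]%classic)).
  apply: fin_bigcap_measurable => // i _.
  by rewrite -[X in measurable X]setTI; apply: measurable_tnth.
apply/seteqP; split => x /= H i; first by move=> _; rewrite /= in_itv/=; exact: H.
by have := H i I; rewrite /= in_itv.
Qed.

(** The law lives on all of R^p while sup-norm bounds hold on the cube only; this transfers them
    under the integral. *)
Lemma unif_cube_ae (R : realType) p :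
  {ae unif_cube p, forall x : design R p, cube x}.
Proof.
exists (~` @cube R p); split => //; first exact: measurableC (@measurable_cube R p).
rewrite probability_setC; last exact: measurable_cube.
have box : @cube R p = [set x | forall i, `[0, 1]%classic (tnth x i : R)].
  by apply/seteqP; split => x /= H i; have := H i; rewrite in_itv.
have -> : unif_cube p (@cube R p) = 1%E.
  rewrite box (iid_law_box (uniform_prob (@ltr01 R)) (A := fun=> `[0, 1]%classic))//.
  rewrite big1// => i _.
  exact: integral_uniform_pdf1.
by rewrite subee.
Qed.

Lemma integral_sqr_L2 (R : realType) p (g : design R p -> R) : L2 g ->
  (\int[unif_cube p]_x (g x ^+ 2)%:E = (L2norm g ^+ 2)%:E)%E.
Proof.
move=> L2g.
(* [L2norm] is a [fine], so finiteness of the norm is needed to recover its true value. *)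
have fin : ('N[unif_cube p]_2%:E[EFin \o g] \is a fin_num)%E.
  move: L2g; rewrite /L2/= inE => /andP[_]; rewrite inE/= /finite_norm => h.
  by rewrite ge0_fin_numE// Lnorm_ge0.
rewrite EFin_expe fineK//.
transitivity ('N[unif_cube p]_2%:E[EFin \o g] `^ 2)%E.
  rewrite poweR_Lnorm//; apply: eq_integral => x _ /=.
  by rewrite powR_mulrn// real_normK ?num_real.
by rewrite -(fineK fin)/= powR_mulrn ?fine_ge0 ?Lnorm_ge0// EFin_expe.
Qed.

Lemma supnorm_sqr_le (R : realType) p (g : design R p -> R) (r : R) :
  (supnorm g ^+ 2 <= r%:E)%E -> forall x, cube x -> g x ^+ 2 <= r.
Proof.
move=> gr x cx; rewrite -lee_fin; apply: le_trans gr.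
rewrite -real_normK ?num_real// EFin_expe !expe2.
have : (`|g x|%:E <= supnorm g)%E by apply: ereal_sup_ubound; exists x.
by move=> h; apply: lee_pmul; rewrite ?lee_fin.
Qed.

(** Since [1 + x <= expR x], it suffices that (1 + x)(1 - x + 2x^2) = 1 + x^2 (1 + 2x) is at least
    1, which is where x >= -1/2 enters. *)
Lemma expRN_le_quadratic (R : realType) (x : R) : - 2^-1 <= x ->
  expR (- x) <= 1 - x + 2 * x ^+ 2.
Proof.
move=> hx; have x1 : 0 < 1 + x by lra.
rewrite expRN invf_ple ?posrE ?expR_gt0//; last by nra.
apply: le_trans (expR_ge1Dx x).
rewrite -div1r ler_pdivrMr; last by nra.
have := sqr_ge0 x; nra.
Qed.

Lemma L2_measurable (R : realType) p (g : design R p -> R) :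
  L2 g -> measurable_fun setT g.
Proof. by rewrite /L2/= inE => /andP[+ _]; rewrite inE. Qed.

Lemma L2_sub (R : realType) p (f g : design R p -> R) :
  L2 f -> L2 g -> L2 (f \- g).
Proof.
have p1 : (1 <= 2%:E :> \bar R)%E by rewrite lee_fin ler1n.
move=> fL gL; have [_ addL] := Lfun_addr_closed (unif_cube p) p1.
exact: addL fL (Lfun_oppr_closed gL).
Qed.

Lemma L2norm_ge0 (R : realType) p (g : design R p -> R) : 0 <= L2norm g.
Proof. by rewrite fine_ge0// Lnorm_ge0. Qed.

Lemma L2norm_subC (R : realType) p (f g : design R p -> R) :
  L2norm (f \- g) = L2norm (g \- f).
Proof.
rewrite /L2norm -oppe_Lnorm; congr (fine (Lnorm _ _ _)).
by apply/funext => x /=; rewrite opprB.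
Qed.

(** The pointwise inequality (g + h)^2 <= 2g^2 + 2h^2, integrated. The separate [k] allows f - f0 to
    be split through f1 without rewriting functions. *)
Lemma L2norm_sqrD_le (R : realType) p (g h k : design R p -> R) :
  L2 g -> L2 h -> L2 k -> (forall x, k x = g x + h x) ->
  L2norm k ^+ 2 <= 2 * L2norm g ^+ 2 + 2 * L2norm h ^+ 2.
Proof.
move=> gL hL kL kE; rewrite -lee_fin EFinD !(EFinM 2) -!integral_sqr_L2//.
have msq (f : design R p -> R) : L2 f ->
    measurable_fun setT (fun x => (f x ^+ 2)%:E).
  by move=> /L2_measurable fL; apply/measurable_EFinP/measurable_funX.
have sq0 (f : design R p -> R) x : (0 <= (f x ^+ 2)%:E)%E.
  by rewrite lee_fin sqr_ge0.
rewrite -!ge0_integralZl_EFin//; [|exact: msq|exact: msq].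
rewrite -ge0_integralD//; last 4 first.
- by move=> x _; rewrite mule_ge0.
- by apply: measurable_funeM; exact: msq.
- by move=> x _; rewrite mule_ge0.
- by apply: measurable_funeM; exact: msq.
apply: ge0_le_integral => //.
- exact: msq.
- by apply: emeasurable_funD; apply: measurable_funeM; exact: msq.
- move=> x _; rewrite -!EFinM -EFinD lee_fin kE.
  by have := sqr_ge0 (g x - h x); nra.
Qed.

(** * Exponential moments of statistics of the data *)

Lemma measurable_data (R : realType) p n (f : design R p -> R) :
  measurable_fun setT f -> measurable_fun setT (@data R p n f).
Proof.
move=> mf; apply/measurable_fun_tnthP => i.
have mD : measurable_fun [set: design R p * measurableTypeR R]
    (fun xe => f xe.1 + xe.2 : R).
  by apply: measurable_funD => //; exact: measurableT_comp.
rewrite (_ : _ \o _ =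
    (fun xe => (xe.1, f xe.1 + xe.2)) \o (@tnth _ _ ^~ i)); last first.
  by apply/funext => w /=; rewrite tnth_map.
apply: measurableT_comp; last exact: measurable_tnth.
apply/measurable_fun_pairP; split; last exact: mD.
exact: measurable_fst.
Qed.

(** Independence turns the expectation of the dominating exponential into an n-th power, and
    integrating out the noise adds b^2 sigma^2 / 2 to the exponent. The domination is stated in
    design points and noise, where [b] multiplies a centred Gaussian. *)
Lemma Ef_expR_le (R : realType) p n (sigma : R) (f a b : design R p -> R)
    (psi : sample R p n -> R) : sigma != 0 ->
  measurable_fun setT f -> measurable_fun setT a -> measurable_fun setT b ->
  measurable_fun setT psi -> (forall D, 0 <= psi D) ->
  (forall w, psi (data f w) <= expR (\sum_(i < n)
    (a (tnth w i).1 + b (tnth w i).1 * (tnth w i).2))) ->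
  (Ef sigma f psi <=
    (\int[unif_cube p]_x (expR (a x + b x ^+ 2 * sigma ^+ 2 / 2))%:E) ^+ n)%E.
Proof.
move=> s0 mf ma mb mpsi psi0 psile.
pose k (z : design R p * measurableTypeR R) := expR (a z.1 + b z.1 * z.2).
have mk : measurable_fun setT k.
  apply: measurableT_comp => //; apply: measurable_funD.
    exact: measurableT_comp.
  by apply: measurable_funM => //; exact: measurableT_comp.
have k0 z : 0 <= k z by exact: expR_ge0.
have -> : (\int[unif_cube p]_x (expR (a x + b x ^+ 2 * sigma ^+ 2 / 2))%:E =
    \int[unif_cube p \x normal_prob 0 sigma]_z (k z)%:E)%E.
  rewrite fubini_tonelli1//; last exact/measurable_EFinP.
  by apply: eq_integral => x _; rewrite -(normal_prob_mgf (a x) (b x) s0).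
rewrite -integral_iid_law_prod// /Ef unlock; apply: ge0_le_integral => //.
- by move=> w _; rewrite lee_fin psi0.
- by apply/measurable_EFinP/measurableT_comp => //; exact: measurable_data.
- apply/measurable_EFinP; apply: measurable_prod => i _.
  by apply: measurableT_comp => //; exact: measurable_tnth.
- by move=> w _; rewrite lee_fin -expR_sum; exact: psile.
Qed.

(** The bound [4 * l * B <= 1] keeps the exponent small enough for the quadratic majorant of the
    exponential; the quadratic term is then absorbed by half of each linear term. *)
Lemma integral_expR_sqr_le (R : realType) p (l B : R) (g h : design R p -> R) :
  L2 g -> L2 h -> 0 <= l -> 4 * l * B <= 1 ->
  (forall x, cube x -> g x ^+ 2 <= B) -> (forall x, cube x -> h x ^+ 2 <= B) ->
  (\int[unif_cube p]_x (expR (- (l * (g x ^+ 2 / 4 - h x ^+ 2))))%:E <=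
   (1 - l * (L2norm g ^+ 2 / 8 - 3 / 2 * L2norm h ^+ 2))%:E)%E.
Proof.
move=> gL hL l0 lB gB hB.
have msq (f : design R p -> R) : L2 f -> measurable_fun setT (fun x => f x ^+ 2).
  by move=> /L2_measurable fL; exact: measurable_funX.
pose E x := expR (- (l * (g x ^+ 2 / 4 - h x ^+ 2))).
have mE : measurable_fun setT E.
  apply: measurableT_comp => //; apply: measurableT_comp => //.
  apply: measurable_funM => //; apply: measurable_funB; last exact: msq.
  by apply: measurable_funM => //; exact: msq.
(* The g-term is moved to the left-hand side: off the cube only nonnegative
   integrands can be compared, and the quadratic majorant may be negative. *)
have le : (\int[unif_cube p]_x (E x)%:E + (l / 8)%:E * (L2norm g ^+ 2)%:E <=
    1 + (3 / 2 * l)%:E * (L2norm h ^+ 2)%:E)%E.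
  have l8 : 0 <= l / 8 by lra.
  have l32 : 0 <= 3 / 2 * l by lra.
  have E0 x : 0 <= E x by exact: expR_ge0.
  (* The constant 1 is written as an integral too, so that the two sides become integrals of
     nonnegative functions. *)
  rewrite -!integral_sqr_L2// -(@probability_setT _ _ _ (unif_cube p)).
  rewrite -[X in (_ <= X + _)%E]mul1e -(@integral_cst _ _ _ (unif_cube p))//.
  rewrite -!ge0_integralZl_EFin//; last 4 first.
  - by move=> x _; rewrite lee_fin sqr_ge0.
  - by apply/measurable_EFinP; exact: msq.
  - by move=> x _; rewrite lee_fin sqr_ge0.
  - by apply/measurable_EFinP; exact: msq.
  have mZ c (f : design R p -> R) : L2 f ->
      measurable_fun setT (fun x => (c%:E * (f x ^+ 2)%:E)%E).
    by move=> fL; apply: measurable_funeM; apply/measurable_EFinP; exact: msq.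
  have Z0 c (f : design R p -> R) x : 0 <= c -> (0 <= c%:E * (f x ^+ 2)%:E)%E.
    by move=> c0; rewrite mule_ge0 ?lee_fin// sqr_ge0.
  rewrite -!ge0_integralD//; try by [move=> x _; exact: Z0|exact: mZ|
    move=> x _; rewrite lee_fin E0|exact/measurable_EFinP].
  apply: ae_ge0_le_integral => //.
  - by move=> x _; apply: adde_ge0; [rewrite lee_fin|exact: Z0].
  - by apply: emeasurable_funD; [exact/measurable_EFinP|exact: mZ].
  - by move=> x _; apply: adde_ge0; [rewrite lee_fin|exact: Z0].
  - by apply: emeasurable_funD => //; exact: mZ.
  - apply: filterS (unif_cube_ae R p) => x /[dup] /gB gBx /hB hBx _.
    rewrite -!EFinM -!EFinD lee_fin /E.
    have g0 := sqr_ge0 (g x); have h0 := sqr_ge0 (h x).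
    set u := l * (g x ^+ 2 / 4); set v := l * h x ^+ 2.
    have u0 : 0 <= u by rewrite /u mulr_ge0//; lra.
    have v0 : 0 <= v by rewrite mulr_ge0.
    have u4 : u <= 4^-1 by rewrite /u; nra.
    have v4 : v <= 4^-1 by rewrite /v; nra.
    have uv : l * (g x ^+ 2 / 4 - h x ^+ 2) = u - v by rewrite mulrBr.
    (* As u and v lie in [0, 1/4], 2(u - v)^2 <= (u + v) / 2, which turns -u + v into -u/2 +
       3v/2. *)
    have := @expRN_le_quadratic R (u - v); rewrite uv => /(_ ltac:(lra)) => ?.
    have -> : l / 8 * g x ^+ 2 = u / 2 by rewrite /u; field.
    have -> : 3 / 2 * l * h x ^+ 2 = 3 / 2 * v by rewrite /v; ring.
    nra.
rewrite -(@leeD2rE _ ((l / 8)%:E * (L2norm g ^+ 2)%:E)%E)//.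
apply: le_trans le _; rewrite -!EFinM -!EFinD lee_fin; lra.
Qed.

(** * The test statistic and the test *)

(** The log-likelihood ratio of f0 + g against f0, times sigma^2, has g^2 / 2 in place of g^2 / 4.
    The weight 1/4 makes the tilt 1 / (2 sigma^2) cancel exactly under f0. *)
Definition lr_stat (R : realType) p n (f0 g : design R p -> R)
    (D : sample R p n) : R :=
  \sum_(i < n) (((tnth D i).2 - f0 (tnth D i).1) * g (tnth D i).1
                - g (tnth D i).1 ^+ 2 / 4).

Definition lr_test (R : realType) p n (f0 g : design R p -> R) (c : R)
    (D : sample R p n) : R :=
  \1_[set D | n%:R * c < lr_stat f0 g D] D.

(** The threshold is shared out as c per observation, so that the exponential of the tilted
    statistic is a product over the sample. *)
Lemma lr_stat_data (R : realType) p n (f f0 g : design R p -> R) (c l : R)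
    (w : sample R p n) :
  l * (lr_stat f0 g (data f w) - n%:R * c) =
  \sum_(i < n) l * ((f (tnth w i).1 + (tnth w i).2 - f0 (tnth w i).1)
                      * g (tnth w i).1 - g (tnth w i).1 ^+ 2 / 4 - c).
Proof.
rewrite -mulr_sumr; congr (_ * _).
rewrite sumrB; congr (_ - _); last by rewrite sumr_const card_ord mulr_natl.
by apply: eq_bigr => i _; rewrite tnth_map.
Qed.

Lemma lr_test_range (R : realType) p n (f0 g : design R p -> R) (c : R)
    (D : sample R p n) : 0 <= lr_test f0 g c D <= 1.
Proof. by rewrite /lr_test indicE; case: (_ \in _); rewrite ?lexx ?ler01. Qed.

Lemma measurable_lr_stat (R : realType) p n (f0 g : design R p -> R) :
  measurable_fun setT f0 -> measurable_fun setT g ->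
  measurable_fun setT (@lr_stat R p n f0 g).
Proof.
move=> mf0 mg; apply: measurable_sum => i.
pose s (z : design R p * measurableTypeR R) : R :=
  (z.2 - f0 z.1) * g z.1 - g z.1 ^+ 2 / 4.
have ms : measurable_fun setT s.
  have mg1 : measurable_fun setT (fun z : design R p * measurableTypeR R => g z.1).
    exact: measurableT_comp.
  apply: measurable_funB; first apply: measurable_funM => //.
    by apply: measurable_funB => //; exact: measurableT_comp.
  by apply: measurable_funM => //; exact: measurable_funX.
exact: (measurableT_comp ms (measurable_tnth i)).
Qed.

Lemma measurable_lr_test (R : realType) p n (f0 g : design R p -> R) (c : R) :
  measurable_fun setT f0 -> measurable_fun setT g ->
  measurable_fun setT (@lr_test R p n f0 g c).
Proof.
move=> mf0 mg; apply: measurable_indic.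
rewrite (_ : [set D | _] = @lr_stat R p n f0 g @^-1` `]n%:R * c, +oo[).
  rewrite -[X in measurable X]setTI.
  by apply: (measurable_lr_stat mf0 mg); [exact: measurableT|exact: measurable_itv].
by apply/seteqP; split => D /=; rewrite in_itv/= andbT.
Qed.

(** Pointwise Chernoff bound: on the rejection region the exponent is nonnegative. *)
Lemma lr_test_le_expR (R : realType) p n (f0 g : design R p -> R) (c l : R)
    (D : sample R p n) : 0 <= l ->
  lr_test f0 g c D <= expR (l * (lr_stat f0 g D - n%:R * c)).
Proof.
move=> l0; rewrite /lr_test indicE; case: (boolP (D \in _)) => [|_].
  by rewrite inE/= => h; rewrite -[leLHS](@expR0 R) ler_expR mulr_ge0// subr_ge0 ltW.
exact: expR_ge0.
Qed.

Lemma lr_testC_le_expR (R : realType) p n (f0 g : design R p -> R) (c l : R)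
    (D : sample R p n) : 0 <= l ->
  1 - lr_test f0 g c D <= expR (- l * (lr_stat f0 g D - n%:R * c)).
Proof.
move=> l0; rewrite /lr_test indicE; case: (boolP (D \in _)) => [_|].
  by rewrite subrr expR_ge0.
rewrite notin_setE/= => /negP; rewrite -leNgt => h.
by rewrite subr0 -[leLHS](@expR0 R) ler_expR mulNr -mulrN mulr_ge0// oppr_ge0 subr_le0.
Qed.

(** * Errors of the first and second kind *)

Lemma Ef_lr_test_le (R : realType) p n (sigma c : R) (f0 g : design R p -> R) :
  0 < sigma -> measurable_fun setT f0 -> measurable_fun setT g ->
  (Ef sigma f0 (@lr_test R p n f0 g c) <=
    (expR (- (n%:R * c / (2 * sigma ^+ 2))))%:E)%E.
Proof.
move=> s0 mf0 mg; pose l := (2 * sigma ^+ 2)^-1.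
have sigma0 : sigma != 0 by rewrite gt_eqF.
have l0 : 0 <= l by rewrite invr_ge0 mulr_ge0// sqr_ge0.
pose a x := - (l * (g x ^+ 2 / 4 + c)).
pose b x := l * g x.
apply: le_trans.
  apply: (Ef_expR_le (a := a) (b := b)) => //.
  - apply: measurableT_comp => //; apply: measurable_funM => //.
    apply: measurable_funD => //; apply: measurable_funM => //.
    exact: measurable_funX.
  - exact: measurable_funM.
  - exact: measurable_lr_test.
  - move=> w; apply: le_trans (lr_test_le_expR _ _ _ _ l0) _.
    rewrite lr_stat_data ler_expR le_eqVlt; apply/orP; left; apply/eqP.
    by apply: eq_bigr => i _; rewrite /a /b; ring.
(* The Gaussian term l^2 sigma^2 g^2 / 2 equals l g^2 / 4 and cancels the penalty in [a], leaving -l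
   c. *)
under eq_integral => x _.
  have -> : a x + b x ^+ 2 * sigma ^+ 2 / 2 = - (c / (2 * sigma ^+ 2)).
    by rewrite /a /b /l; field.
  over.
rewrite integral_cst// [X in (_ * X)%E]probability_setT mule1 -EFin_expe.
by rewrite -expRM_natl mulrN mulrA.
Qed.

(* With h = f - f1 and g = f1 - f0, completing the square in the cross term
   g * h and absorbing the Gaussian term into g^2 (this is what l * sigma^2 <=
   1/2 is for) leaves the exponent -l (g^2 / 4 - h^2) at each design point. *)
Lemma Ef_lr_testC_le (R : realType) p n (sigma l B : R)
    (f f0 f1 : design R p -> R) :
  0 < sigma -> 0 <= l -> l * sigma ^+ 2 <= 2^-1 -> 4 * l * B <= 1 ->
  L2 f -> L2 f0 -> L2 f1 ->
  (forall x, cube x -> (f1 \- f0) x ^+ 2 <= B) ->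
  (forall x, cube x -> (f \- f1) x ^+ 2 <= B) ->
  25 * L2norm (f \- f1) ^+ 2 <= L2norm (f1 \- f0) ^+ 2 ->
  (Ef sigma f (fun D => 1 - @lr_test R p n f0 (f1 \- f0)
                              (L2norm (f1 \- f0) ^+ 2 / 32) D)%R <=
    (expR (- (l * n%:R * L2norm (f1 \- f0) ^+ 2 / 32)))%:E)%E.
Proof.
move=> s0 l0 ls lB fL f0L f1L.
have := L2_sub f1L f0L; have := L2_sub fL f1L.
set g := f1 \- f0; set h := f \- f1; move=> hL gL gB hB hg.
have [mf mf0] := (L2_measurable fL, L2_measurable f0L).
have [mg mh] := (L2_measurable gL, L2_measurable hL).
have sigma0 : sigma != 0 by rewrite gt_eqF.
set c := L2norm g ^+ 2 / 32.
pose a x := l * (c - (g x + h x) * g x + g x ^+ 2 / 4).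
pose b x := - l * g x.
have ma : measurable_fun setT a.
  apply: measurable_funM => //; apply: measurable_funD.
    apply: measurable_funB => //; apply: measurable_funM => //.
    exact: measurable_funD.
  by apply: measurable_funM => //; exact: measurable_funX.
have mb : measurable_fun setT b by exact: measurable_funM.
apply: le_trans.
  apply: (Ef_expR_le (a := a) (b := b)) => //.
  - by apply: measurable_funB => //; exact: measurable_lr_test.
  - by move=> D; rewrite subr_ge0; case/andP: (lr_test_range f0 g c D).
  - move=> w; apply: le_trans (lr_testC_le_expR _ _ _ _ l0) _.
    rewrite lr_stat_data ler_expR le_eqVlt; apply/orP; left; apply/eqP.
    by apply: eq_bigr => i _; rewrite /a /b /h /g /=; ring.
have le1 : (\int[unif_cube p]_x (expR (a x + b x ^+ 2 * sigma ^+ 2 / 2))%:E <=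
    (expR (- (l * c)))%:E)%E.
  apply: (@le_trans _ _ ((expR (l * c))%:E *
      \int[unif_cube p]_x (expR (- (l * (g x ^+ 2 / 4 - h x ^+ 2))))%:E)%E).
    have mE : measurable_fun setT
        (fun x => (expR (- (l * (g x ^+ 2 / 4 - h x ^+ 2))))%:E).
      apply/measurable_EFinP/measurableT_comp => //; apply: measurableT_comp => //.
      apply: measurable_funM => //; apply: measurable_funB.
        by apply: measurable_funM => //; exact: measurable_funX.
      exact: measurable_funX.
    rewrite -ge0_integralZl_EFin ?expR_ge0//.
    apply: ge0_le_integral => //.
    - apply/measurable_EFinP/measurableT_comp => //.
      apply: measurable_funD => //; apply: measurable_funM => //.
      by apply: measurable_funM => //; exact: measurable_funX.
    - exact: measurable_funeM.
    - move=> x _; rewrite -EFinM lee_fin -expRD ler_expR /a /b.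
      have := sqr_ge0 (g x); have := sqr_ge0 (g x / 2 + h x).
      move: (g x) (h x) => u v uv0 u0.
      have : l * (l * sigma ^+ 2) * u ^+ 2 <= l * 2^-1 * u ^+ 2.
        by rewrite ler_wpM2r// ler_wpM2l.
      have : 0 <= l * (u / 2 + v) ^+ 2 by rewrite mulr_ge0.
      nra.
  apply: (@le_trans _ _ ((expR (l * c))%:E *
      (1 - l * (L2norm g ^+ 2 / 8 - 3 / 2 * L2norm h ^+ 2))%:E)%E).
    apply: lee_pmul => //; rewrite ?lee_fin ?expR_ge0//.
      by apply: integral_ge0 => x _; rewrite lee_fin expR_ge0.
    exact: (integral_expR_sqr_le (B := B)).
  rewrite -EFinM lee_fin.
  (* The hypothesis [hg] gives (3/2) |h|^2 <= (3/50) |g|^2 <= |g|^2 / 16, so a decay of l |g|^2 / 16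
     survives. The threshold costs half of it, l c, and the bound 1 - t <= exp (-t) concludes. *)
  have -> : - (l * c) = l * c + - (l * (L2norm g ^+ 2 / 16)) by rewrite /c; field.
  rewrite expRD ler_wpM2l ?expR_ge0//.
  apply: le_trans (expR_ge1Dx _); rewrite lerD2l lerN2 ler_wpM2l//.
  by have := sqr_ge0 (L2norm g); lra.
apply: (@le_trans _ _ ((expR (- (l * c)))%:E ^+ n)%E).
  elim: n => [|k IH]; first by rewrite !expe0.
  rewrite !expeS; apply: lee_pmul => //.
  - by apply: integral_ge0 => x _; rewrite lee_fin expR_ge0.
  - by apply/expe_ge0/integral_ge0 => x _; rewrite lee_fin expR_ge0.
rewrite -EFin_expe -expRM_natl lee_fin ler_expR /c le_eqVlt.
by apply/orP; left; apply/eqP; ring.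
Qed.

(** * Choice of the constants and conclusion *)

Theorem lemma2p1 (R : realType) (eta sigma : R)
    (eta_gt0 : 0 < eta) (sigma_gt0 : 0 < sigma) :
  exists C xi : R, [/\ 0 < C, 0 < xi < 1 &
    forall (p m n : nat) (delta : R) (f0 : design R p -> R)
        (F : set (design R p -> R)),
      (0 < p)%N -> (0 < m)%N -> 0 < delta ->
      L2 f0 -> F `<=` @L2 R p ->
      (forall f, F f ->
        (supnorm (f \- f0)%R ^+ 2 <=
          (eta * (m%:R * L2norm (f \- f0) ^+ 2 + delta ^+ 2))%:E)%E) ->
      forall f1, F f1 -> Num.sqrt n%:R * L2norm (f1 \- f0) > 1 ->
      exists phi : sample R p n -> R,
        [/\ measurable_fun setT phi,
            forall D, 0 <= phi D <= 1,
            (Ef sigma f0 phi <=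
              (expR (- (C * n%:R * L2norm (f1 \- f0) ^+ 2)))%:E)%E &
            (ereal_sup ([set Ef sigma f (fun D => 1 - phi D) | f in
                [set f | F f /\
                  L2norm (f \- f1) <= xi * L2norm (f0 \- f1)]])%R <=
              (expR (- (C * n%:R * L2norm (f1 \- f0) ^+ 2)) +
               2 * expR (- (C * n%:R * L2norm (f1 \- f0) ^+ 2 /
                 (m%:R * L2norm (f1 \- f0) ^+ 2 + delta ^+ 2))))%:E)%E]].
Proof.
have s2 : 0 < sigma ^+ 2 by rewrite exprn_gt0.
(* The exponent l n D^2 / 32 is evaluated at the two possible tilts: 64 = 32 * 2, and 1024 = 32 * 4
   * 8, the 8 coming from [B]. *)
pose C := Num.min (64 * sigma ^+ 2)^-1 (1024 * eta)^-1.
have C1 : C <= (64 * sigma ^+ 2)^-1 by rewrite ge_min lexx.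
have C2 : C <= (1024 * eta)^-1 by rewrite ge_min lexx orbT.
have C0 : 0 < C by rewrite lt_min !invr_gt0; apply/andP; split; lra.
(* Squaring 1/5 gives the factor 25 required by [Ef_lr_testC_le]. *)
exists C, 5^-1; split=> //; first by apply/andP; split; lra.
move=> p m n delta f0 F _ m0 delta0 f0L FL Fsup f1 Ff1 _.
have f1L := FL _ Ff1; have gL := L2_sub f1L f0L.
set D2 := L2norm (f1 \- f0) ^+ 2; set M := m%:R * D2 + delta ^+ 2.
have D20 : 0 <= D2 by exact: sqr_ge0.
have M0 : 0 < M by rewrite ltr_wpDl ?exprn_gt0// mulr_ge0.
have nD0 : 0 <= n%:R * D2 by rewrite mulr_ge0.
exists (lr_test f0 (f1 \- f0) (D2 / 32)); split.
- by apply: measurable_lr_test; exact: L2_measurable.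
- exact: lr_test_range.
- apply: le_trans (Ef_lr_test_le _ _ _ _ _) _ => //;
    try exact: L2_measurable.
  rewrite lee_fin ler_expR lerN2.
  have -> : n%:R * (D2 / 32) / (2 * sigma ^+ 2) =
      (64 * sigma ^+ 2)^-1 * (n%:R * D2) by field; rewrite gt_eqF.
  by rewrite -mulrA ler_wpM2r.
apply: ge_ereal_sup => _ [f [Ff fxi] <-].
have fL := FL _ Ff; have hL := L2_sub fL f1L.
have kL := L2_sub fL f0L.
have hg : 25 * L2norm (f \- f1) ^+ 2 <= D2.
  move: fxi; rewrite (L2norm_subC f0) /D2.
  have := L2norm_ge0 (f \- f1); have := L2norm_ge0 (f1 \- f0).
  move: (L2norm _) (L2norm _) => u v u0 v0 vu; nra.
(* The sup-norm condition bounds f - f0, not f - f1, so the L2-norm of f - f0 is first compared with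
   that of f1 - f0; here 2/25 + 2 <= 3. *)
have kD : L2norm (f \- f0) ^+ 2 <= 3 * D2.
  have : L2norm (f \- f0) ^+ 2 <= 2 * L2norm (f \- f1) ^+ 2 + 2 * D2.
    by apply: L2norm_sqrD_le => // x /=; ring.
  by move: hg; lra.
have gM x : cube x -> (f1 \- f0) x ^+ 2 <= eta * M.
  exact: supnorm_sqr_le (Fsup _ Ff1) x.
have kM x : cube x -> (f \- f0) x ^+ 2 <= 3 * eta * M.
  move=> /(supnorm_sqr_le (Fsup _ Ff))/le_trans; apply.
  have -> : 3 * eta * M = eta * (3 * M) by ring.
  rewrite ler_wpM2l ?(ltW eta_gt0)// /M.
  have : m%:R * L2norm (f \- f0) ^+ 2 <= m%:R * (3 * D2) by rewrite ler_wpM2l.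
  have := sqr_ge0 delta; lra.
(* Since f - f1 = (f - f0) - (f1 - f0), its square is at most 2 * 3 eta M + 2 * eta M = 8 eta M. *)
pose B := 8 * (eta * M).
have B0 : 0 < B by have := mulr_gt0 eta_gt0 M0; rewrite /B; lra.
pose l := Num.min (2 * sigma ^+ 2)^-1 (4 * B)^-1.
have l0 : 0 < l by rewrite lt_min !invr_gt0; apply/andP; split; lra.
have ls : l * sigma ^+ 2 <= 2^-1.
  by rewrite -ler_pdivlMr// -invfM ge_min lexx.
have lB : 4 * l * B <= 1.
  have B40 : 0 < 4 * B by lra.
  by rewrite mulrAC -ler_pdivlMl// mulr1 ge_min lexx orbT.
have gB x : cube x -> (f1 \- f0) x ^+ 2 <= B.
  by move=> /gM; rewrite /B; have := mulr_gt0 eta_gt0 M0; lra.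
have hB x : cube x -> (f \- f1) x ^+ 2 <= B.
  move=> cx; have := gM x cx; have := kM x cx; rewrite /B /=.
  have := sqr_ge0 (f x - f0 x + (f1 x - f0 x)); nra.
have := Ef_lr_testC_le n sigma_gt0 (ltW l0) ls lB fL f0L f1L gB hB hg.
move=> /le_trans; apply.
rewrite lee_fin -/D2.
set e1 := expR (- (C * _ * _)); set e2 := expR (- (C * _ * _ / _)).
have [e10 e20] : 0 <= e1 /\ 0 <= e2 by split; exact: expR_ge0.
(* Whichever constraint determines [l], one of the two exponentials alone dominates, and the other
   terms of the bound are nonnegative. *)
suff [|] : expR (- (l * n%:R * D2 / 32)) <= e1 \/ expR (- (l * n%:R * D2 / 32)) <= e2.
- lra.
- lra.
rewrite /e1 /e2 !ler_expR !lerN2 -/M.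
have [h|h] := leP (2 * sigma ^+ 2)^-1 (4 * B)^-1.
- left; rewrite /l min_l//.
  have -> : (2 * sigma ^+ 2)^-1 * n%:R * D2 / 32 =
      (64 * sigma ^+ 2)^-1 * (n%:R * D2) by field; rewrite gt_eqF.
  by rewrite -mulrA ler_wpM2r.
- right; rewrite /l min_r; last exact: ltW.
  have -> : (4 * B)^-1 * n%:R * D2 / 32 =
      (1024 * eta)^-1 * (n%:R * D2 / M).
    by rewrite /B; field; rewrite !gt_eqF.
  have -> : C * n%:R * D2 / M = C * (n%:R * D2 / M) by rewrite !mulrA.
  by rewrite ler_wpM2r// divr_ge0// ltW.
Qed.
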